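(* Let $0<p<1$, $0<r<1$ and $0<\lambda<\frac{r}{p+r}$. For a network with Bernoulli packet arrivals at rate $\lambda$ over the Gilbert-Elliott erasure channel $GE(p,r)$, the average age of information under the first-come-first-served (FCFS) policy is $$\bar\Delta_{BF}=\frac{1}{\lambda}+\frac{p}{r}\left[\frac{1}{p+r}+\frac{\lambda^2}{\bigl(r-(p+r)\lambda\bigr)\bigl(r-(p+r)\lambda+\lambda\bigr)}\right].$$
   Context: Time is slotted, $t=1,2,\dots$. Packets are generated (equivalently, arrive at the transmitter) at the beginning of a slot. At most one packet is transmitted per slot; a packet transmitted in slot $t$ and not erased is received at the end of slot $t$, i.e. is available at the receiver at the beginning of slot $t+1$. A packet may be transmitted in the same slot in which it is generated. Channel $GE(p,r)$: the channel state is a two-state Markov chain on $\{G,B\}$ (one step per slot) with transition probability $p$ from $G$ to $B$ and $r$ from $B$ to $G$. A transmission in a slot with state $G$ always succeeds (erasure probability $0$), and in a slot with state $B$ always fails (erasure probability $1$). Bernoulli arrival at rate $\lambda$: in each slot a new packet arrives with probability $\lambda$ and no packet arrives with probability $1-\lambda$, independently over slots and independently of the channel. FCFS policy: the transmitter has an infinite buffer (initially empty) and serves packets in order of generation; a packet is transmitted, repeatedly until success, only after all earlier packets have been successfully delivered. Age of information (AoI): at the beginning of slot $t$, $\Delta_t=t-u_t$, where $u_t$ is the generation slot of the latest (most recently generated) packet received by the beginning of slot $t$. The average AoI is the long-run time average $\lim_{\tau\to\infty}\frac1\tau\sum_{t=1}^{\tau}\Delta_t$ (almost surely; the value assigned before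 the first delivery is irrelevant). *)

(* Defs.v *)
(* MathComp-Analysis *)
From HB Require Import structures.
From mathcomp Require Import all_boot all_order all_algebra finmap.
From mathcomp Require Import all_classical all_reals all_analysis.

Set Implicit Arguments.
Unset Strict Implicit.
Unset Printing Implicit Defensive.

Import Order.TTheory GRing.Theory Num.Theory.
Import numFieldNormedType.Exports.

Local Open Scope classical_set_scope.
Local Open Scope ring_scope.

Section independence.
Context {d d' : measure_display} {T : measurableType d} {E : measurableType d'}.
Context {R : realType} (P : probability T R) {I : choiceType} (D : set I).

Definition mutually_independent (X : I -> {RV P >-> E}) : Prop :=
  forall (J : {fset I}) (B : I -> set E),
    [set` J] `<=` D -> (forall i, measurable (B i)) ->
    P (\bigcap_(i in [set` J]) (X i @^-1` B i)) =
    (\prod_(i <- J) P (X i @^-1` B i))%E.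

(* Independence of the two processes [X] and [Y] as a whole (equivalently, of
   the sigma-algebras they generate): the cylinders below are pi-systems. *)
Definition independent_processes (X Y : I -> {RV P >-> E}) : Prop :=
  forall (J K : {fset I}) (B C : I -> set E),
    [set` J] `<=` D -> [set` K] `<=` D ->
    (forall i, measurable (B i)) -> (forall i, measurable (C i)) ->
    P ((\bigcap_(i in [set` J]) (X i @^-1` B i)) `&`
       (\bigcap_(i in [set` K]) (Y i @^-1` C i))) =
    (P (\bigcap_(i in [set` J]) (X i @^-1` B i)) *
     P (\bigcap_(i in [set` K]) (Y i @^-1` C i)))%E.

End independence.

(* Slots are the positive integers; the value of a slot-indexed process at
   index 0 is never used. *)
Definition slots : set nat := [set t | (0 < t)%N].

Section stochastic_model.
Context {d : measure_display} {T : measurableType d} {R : realType}.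
Context (P : probability T R).

(* The channel state is encoded by a boolean: [true] is G, [false] is B. *)
Definition GE_transition (p r : R) (x y : bool) : R :=
  if x then (if y then 1 - p else p) else (if y then r else 1 - r).

(* Law of a Markov chain, in product form so as not to condition on null events.
   The distribution of the state in slot 1 is left arbitrary. *)
Definition GE_channel (p r : R) (S : nat -> {RV P >-> bool}) : Prop :=
  forall (n : nat) (x : nat -> bool), (0 < n)%N ->
    P [set w | forall t, (0 < t <= n.+1)%N -> S t w = x t] =
    (P [set w | forall t, (0 < t <= n)%N -> S t w = x t] *
     (GE_transition p r (x n) (x n.+1))%:E)%E.

Definition bernoulli_arrivals (lambda : R) (A : nat -> {RV P >-> bool}) : Prop :=
  (forall t, (0 < t)%N -> P [set w | A t w = true] = lambda%:E) /\
  mutually_independent slots A.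

End stochastic_model.

(* FCFS on one sample path: [a t] says that a packet is generated in slot [t]
   and [s t] that the channel is good in slot [t]. A packet is identified with
   its generation slot. *)
Section fcfs.
Variables a s : nat -> bool.

(* The undelivered packets at the end of slot [t], in order of generation. *)
Fixpoint backlog (t : nat) : seq nat :=
  if t is t'.+1 then
    let b := backlog t' ++ (if a t then [:: t] else [::]) in
    if s t then behead b else b
  else [::].

(* The packets available for transmission in slot [t > 0]: those left over from
   the previous slots, and the one generated in slot [t], if any. *)
Definition buffer (t : nat) : seq nat :=
  backlog t.-1 ++ (if a t then [:: t] else [::]).

Definition fcfs_delivered (t : nat) : option nat :=
  if s t then ohead (buffer t) else None.

(* Generation slot of the most recently generated packet among those delivered
   before slot [t]; it is 0 by convention before the first delivery. *)
Definition fcfs_latest (t : nat) : nat :=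
  \max_(1 <= i < t) odflt 0%N (fcfs_delivered i).

Definition fcfs_age (R : realType) (t : nat) : R :=
  t%:R - (fcfs_latest t)%:R.

End fcfs.

Definition time_average (R : realType) (f : nat -> R) (tau : nat) : R :=
  tau%:R^-1 * \sum_(1 <= t < tau.+1) f t.

(* Main.v *)
Require Import Defs.
From HB Require Import structures.
From mathcomp Require Import all_boot all_order all_algebra finmap.
From mathcomp Require Import all_classical all_reals all_analysis.
From mathcomp Require Import ring lra zify.

(* The age before slot [n.+1], the channel state and the gaps between the
   generation slots of the buffered packets form a Markov chain.  Its Poisson
   equation [E (V next) = V - age + mean_age] has an explicit solution [V].  The
   age counts the slots [j] such that the first packet generated after [j] is
   still undelivered; [V] sums over these [j] the expected remaining time to that
   delivery, and adds a quadratic function of the queue length with a geometric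
   correction.  Hence [\sum (age - mean_age) + V] is a martingale.  A geometric
   Lyapunov function bounds the fourth moment of the age uniformly in time, so
   that the centred sum of the first [n] ages has second moment [O(n)].  By
   Chebyshev and Borel-Cantelli the averages converge almost surely along the
   squares, and, the ages being nonnegative, along all integers. *)

Set Implicit Arguments.
Unset Strict Implicit.
Unset Printing Implicit Defensive.

Import Order.TTheory GRing.Theory Num.Theory.
Import numFieldNormedType.Exports.

Local Open Scope classical_set_scope.
Local Open Scope ring_scope.

(** * The Poisson equation in the queue length *)

Section poisson.
Context (R : realType) (p r lambda : R).
Hypotheses (hp : 0 < p < 1) (hr : 0 < r < 1).
Hypothesis (hl : 0 < lambda < r / (p + r)).

Definition mean_age : R :=
  lambda^-1 + p / r * ((p + r)^-1 +
    lambda ^+ 2 / ((r - (p + r) * lambda) * (r - (p + r) * lambda + lambda))).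

(* The [k]-th packet of the buffer needs [kappa * k + delta s] further slots on
   average when the channel is in state [s]. *)
Definition kappa : R := (p + r) / r.
Definition delta (s : bool) : R := if s then 0 else (1 - p - r) / r.
(* The generating function, at [1 - lambda], of the number of slots from a good
   slot to the next one; [gamma] is the corresponding eigenvector. *)
Definition theta : R :=
  (1 - lambda) * (r - (p + r) * lambda + lambda) / (r + lambda - r * lambda).
Definition gamma (s : bool) : R :=
  kappa / (1 - theta) * (if s then theta
                     else (1 - lambda) * r / (r + lambda - r * lambda)).
Definition alpha : R := kappa * (p + r) / (2 * (r - (p + r) * lambda)).
Definition mu_coef (s : bool) : R :=
  alpha - kappa * (1 - lambda) / (lambda * theta) +
  (if s then 0 else (2 * alpha * (lambda - r) + kappa) / r).
Definition nu_coef (s : bool) : R :=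
  if s then 0 else
  (mean_age - kappa - alpha * ((1 - lambda) * (1 - p) + lambda * p)
   + (1 - p) * mu_coef true * (1 - lambda) - p * mu_coef false * lambda) / p.
Arguments nu_coef : simpl never.
Definition eta_coef (s : bool) : R := - gamma s * (1 - lambda) / (lambda * theta).

(* Expected time until the delivery of the first packet generated after the
   current slot, given the channel state and the number of buffered packets. *)
Definition mean_wait (s : bool) (q : nat) : R :=
  kappa * q.+1%:R + delta s + gamma s * theta ^+ q.
(* The choice of [mu_coef] makes this invariant under [0 |-> -1] at [s = true],
   which is the boundary condition at the empty queue; that of [nu_coef] fixes
   the constant, and thereby [mean_age]. *)
Definition quad_corr (s : bool) (q : nat) : R :=
  alpha * q%:R ^+ 2 + mu_coef s * q%:R + nu_coef s + eta_coef s * theta ^+ q.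

Local Notation tr := (GE_transition p r).

Lemma params : [/\ 0 < lambda, lambda < 1, 0 < r - (p + r) * lambda,
  0 < r + lambda - r * lambda & 0 < p + r].
Proof.
move: hp hr => /andP[p0 p1] /andP[r0 r1].
have pr0 : 0 < p + r by lra.
move: hl; rewrite ltr_pdivlMr // => /andP[l0 l1].
have l2 : lambda < 1 by rewrite -(ltr_pM2r pr0); lra.
split => //; [lra|nra].
Qed.

Lemma theta_gt0 : 0 < theta.
Proof.
have [l0 l1 h1 h2 pr0] := params.
by rewrite /theta divr_gt0 // mulr_gt0 //; lra.
Qed.

Lemma one_sub_theta :
  1 - theta = lambda * (r + (1 - lambda) * p + lambda * (1 - r)) / (r + lambda - r * lambda).
Proof.
have [l0 l1 h1 h2 pr0] := params.
by rewrite /theta; field; rewrite gt_eqF.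
Qed.

Lemma theta_lt1 : theta < 1.
Proof.
have [l0 l1 h1 h2 pr0] := params.
move: hp hr => /andP[p0 p1] /andP[r0 r1].
rewrite -subr_gt0 one_sub_theta divr_gt0 // mulr_gt0 //; nra.
Qed.

(** Up to the factor [kappa / (1 - theta)], [gamma s] is the mean of [(1 - lambda) ^+ N], with [N]
    the number of slots from state [s] to the next good slot. This is first-step analysis for that
    mean, multiplied by [theta]. *)
Lemma gamma_rec s :
  (1 - lambda) * (tr s true * gamma true + tr s false * gamma false * theta)
  = theta * gamma s.
Proof.
have [l0 l1 h1 h2 pr0] := params.
have := theta_gt0; have := theta_lt1 => t1 t0.
have n1 : 1 - theta != 0 by lra.
have n2 : r + lambda - r * lambda != 0 by lra.
rewrite /gamma.
suff : (1 - lambda) * (tr s true * theta +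
    tr s false * ((1 - lambda) * r / (r + lambda - r * lambda)) * theta) =
    theta * (if s then theta else (1 - lambda) * r / (r + lambda - r * lambda)).
  move=> E; rewrite [RHS]mulrCA -E; ring.
by case: s; rewrite /= /theta; field.
Qed.


(** First-step analysis. Without an arrival the wait starts afresh from the new state. A packet
    arriving in this slot is the awaited one: it takes position [q.+1] after a good slot and [q.+2]
    after a bad one. *)
Lemma mean_wait_rec s q :
  tr s true * ((1 - lambda) * mean_wait true q + lambda * (kappa * q.+1%:R)) +
  tr s false * ((1 - lambda) * mean_wait false q.+1 + lambda * (kappa * q.+2%:R + delta false))
  = mean_wait s q.+1 - 1.
Proof.
have /andP[r0 _] := hr.
have rn : r != 0 by rewrite gt_eqF.
have G := gamma_rec s.
rewrite /mean_wait !exprS -!natr1; set Q := q%:R; set T := theta ^+ q.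
rewrite [gamma s * _]mulrA [gamma s * theta]mulrC -G.
clear G; case: s; rewrite /= /kappa; field; exact: rn.
Qed.

(** This fixes the normalization of [gamma]: the formula of [mean_wait true], read at [q = -1], then
    agrees with its value at [q = 0]. *)
Lemma gamma_true : gamma true = theta * (gamma true + kappa).
Proof.
have n1 : 1 - theta != 0 by rewrite gt_eqF // subr_gt0 theta_lt1.
by rewrite /gamma; field.
Qed.

(** At the empty queue a good slot delivers an arriving packet at once, so this case adds nothing.
    By [gamma_true] this is [mean_wait_rec] read at [q = -1]. *)
Lemma mean_wait_rec0 s :
  tr s true * ((1 - lambda) * mean_wait true 0) +
  tr s false * ((1 - lambda) * mean_wait false 0 + lambda * (kappa + delta false))
  = mean_wait s 0 - 1.
Proof.
have /andP[r0 _] := hr.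
have rn : r != 0 by rewrite gt_eqF.
have tn : theta != 0 by rewrite gt_eqF // theta_gt0.
have G := gamma_rec s.
have {}G : gamma s = (1 - lambda) * (tr s true * (gamma true + kappa) + tr s false * gamma false).
  apply: (mulfI tn); rewrite -G [in LHS]gamma_true; ring.
rewrite /mean_wait !expr0 G.
clear G; case: s; rewrite /= /kappa; field; exact: rn.
Qed.

(** This is the [theta ^+ q] part of the Poisson equation. As [eta_coef] is a multiple of [gamma],
    [gamma_rec] applies; an independent arrival multiplies [theta ^+ q] by
    [1 - lambda + lambda * theta] on average. *)
Lemma eta_coef_rec s :
  (1 - lambda + lambda * theta) *
    (tr s true * eta_coef true + tr s false * eta_coef false * theta)
  = theta * (eta_coef s - gamma s).
Proof.
have [l0 l1 _ _ _] := params.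
have tn : theta != 0 by rewrite gt_eqF // theta_gt0.
have ln : lambda != 0 by rewrite gt_eqF.
have l1n : 1 - lambda != 0 by lra.
have G := gamma_rec s.
have E : eta_coef s - gamma s = - (1 - lambda + lambda * theta) / (lambda * theta) * gamma s.
  by rewrite /eta_coef; field; rewrite tn ln.
have {}G : gamma s =
    (1 - lambda) * (tr s true * gamma true + tr s false * gamma false * theta) / theta.
  by rewrite G; field.
by rewrite E G /eta_coef; field; rewrite tn ln.
Qed.

(** The boundary condition that [quad_corr true] takes the same value at [-1] and at [0], solved for
    [mu_coef true]. *)
Lemma mu_coef_true : mu_coef true = alpha - eta_coef true * (1 - theta^-1).
Proof.
have [l0 l1 _ _ _] := params.
have tn : theta != 0 by rewrite gt_eqF // theta_gt0.
have ln : lambda != 0 by rewrite gt_eqF.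
have n1 : 1 - theta != 0 by rewrite gt_eqF // subr_gt0 theta_lt1.
by rewrite /mu_coef /eta_coef /gamma; field; rewrite n1 tn ln.
Qed.

(** This is the part of the Poisson equation linear in the queue length. Averaging over the
    stationary channel law cancels [mu_coef] and leaves [2 * alpha * (lambda - r / (p + r)) = -
    kappa], which determines [alpha]. *)
Lemma lin_rec s :
  2 * alpha * (lambda - tr s true) + (tr s true * mu_coef true + tr s false * mu_coef false)
  - mu_coef s = - kappa.
Proof.
have [l0 l1 h1 _ _] := params.
have /andP[r0 _] := hr.
have rn : r != 0 by rewrite gt_eqF.
have hn : r - (p + r) * lambda != 0 by rewrite gt_eqF.
rewrite /mu_coef; case: s => /=; rewrite /alpha /kappa; set M := _ / (_ * theta); field;
  rewrite ?rn ?hn //.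
Qed.

(** This is the constant part of the Poisson equation. The case [s = true] is solved by the
    definition of [nu_coef false]; the case [s = false] is then the solvability condition that
    forces the value of [mean_age]. *)
Lemma const_rec s :
  alpha * ((1 - lambda) * tr s true + lambda * tr s false)
  + tr s true * (mu_coef true * (lambda - 1) + nu_coef true)
  + tr s false * (mu_coef false * lambda + nu_coef false) - nu_coef s
  = mean_age - kappa - delta s.
Proof.
have [l0 l1 h1 h2 h3] := params.
have /andP[r0 _] := hr.
have /andP[p0 _] := hp.
have rn : r != 0 by rewrite gt_eqF.
have pn : p != 0 by rewrite gt_eqF.
have ln : lambda != 0 by rewrite gt_eqF.
have hn : r - (p + r) * lambda != 0 by rewrite gt_eqF.
have h2n : r + lambda - r * lambda != 0 by rewrite gt_eqF.
have prn : p + r != 0 by rewrite gt_eqF.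
have l1n : 1 - lambda != 0 by lra.
have hln : r - (p + r) * lambda + lambda != 0 by lra.
have M : kappa * (1 - lambda) / (lambda * theta) =
   (p + r) * (r + lambda - r * lambda) / (r * lambda * (r - (p + r) * lambda + lambda)).
  by rewrite /kappa /theta; field; rewrite ?rn ?ln ?h2n ?hln ?l1n.
rewrite /nu_coef /mu_coef M /delta.
case: s => /=; rewrite /alpha /kappa /mean_age; field; rewrite ?pn ?rn ?ln ?hn ?h2n ?hln ?prn //.
Qed.

Lemma quad_corr_rec s q :
  tr s true * ((1 - lambda) * quad_corr true q + lambda * quad_corr true q.+1) +
  tr s false * ((1 - lambda) * quad_corr false q.+1 + lambda * quad_corr false q.+2)
  = quad_corr s q.+1 - mean_wait s q.+1 + mean_age.
Proof.
have T : tr s true + tr s false = 1 by case: s => /=; ring.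
rewrite /quad_corr /mean_wait !exprS !expr0 -!natr1; set Q := q%:R; set Th := theta ^+ q.
have E := eta_coef_rec s; have Ln := lin_rec s; have C := const_rec s.
have -> : mean_age = alpha * ((1 - lambda) * tr s true + lambda * tr s false)
  + tr s true * (mu_coef true * (lambda - 1) + nu_coef true)
  + tr s false * (mu_coef false * lambda + nu_coef false) - nu_coef s + kappa + delta s.
  by rewrite C; ring.
have -> : kappa = - (2 * alpha * (lambda - tr s true) +
  (tr s true * mu_coef true + tr s false * mu_coef false)
  - mu_coef s) by rewrite Ln opprK.
have -> : forall X Y Z : R, X + eta_coef s * (theta * Th) - (Y + gamma s * (theta * Th)) + Z =
   X - Y + Z + (1 - lambda + lambda * theta) *
    (tr s true * eta_coef true + tr s false * eta_coef false * theta) * Th.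
  by move=> X Y Z; rewrite E; ring.
have -> : tr s false = 1 - tr s true by rewrite -T; ring.
ring.
Qed.

(** A good slot leaves an empty queue empty, with or without an arrival. By [mu_coef_true] this is
    [quad_corr_rec] read at [q = -1]. *)
Lemma quad_corr_rec0 s :
  tr s true * quad_corr true 0 +
  tr s false * ((1 - lambda) * quad_corr false 0 + lambda * quad_corr false 1)
  = quad_corr s 0 - mean_wait s 0 + mean_age.
Proof.
have tn : theta != 0 by rewrite gt_eqF // theta_gt0.
have T : tr s true + tr s false = 1 by case: s => /=; ring.
rewrite /quad_corr /mean_wait !expr1 !expr0 expr0n /= !mulr0 !mulr1 !add0r.
have E := eta_coef_rec s; have Ln := lin_rec s; have C := const_rec s.
have -> : mean_age = alpha * ((1 - lambda) * tr s true + lambda * tr s false)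
  + tr s true * (mu_coef true * (lambda - 1) + nu_coef true)
  + tr s false * (mu_coef false * lambda + nu_coef false) - nu_coef s + kappa + delta s.
  by rewrite C; ring.
have {}E : eta_coef s - gamma s = (1 - lambda + lambda * theta) *
    (tr s true * eta_coef true + tr s false * eta_coef false * theta) / theta.
  by rewrite E; field.
have -> : eta_coef s = eta_coef s - gamma s + gamma s by ring.
rewrite E mu_coef_true.
have -> : tr s false = 1 - tr s true by rewrite -T; ring.
have -> : nu_coef true = 0 by [].
by field.
Qed.

End poisson.

(** * The state of the queue *)

Section weighted_sum.
Local Open Scope nat_scope.

(** The sum of all suffix sums: each entry is weighted by its position counted from one, that is, by
    the number of good slots its packet still needs. *)
Fixpoint wsum (ys : seq nat) : nat :=
  if ys is y :: ys' then y + sumn ys' + wsum ys' else 0.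

Lemma wsum_rcons ys x : wsum (rcons ys x) = wsum ys + (size ys).+1 * x.
Proof.
elim: ys => [|y ys IH] /=; first lia.
rewrite IH sumn_rcons; lia.
Qed.

Lemma wsum_le ys : wsum ys <= size ys * sumn ys.
Proof. by elim: ys => [|y ys IH] //=; nia. Qed.

Lemma size_le_sumn ys : all (ltn 0) ys -> size ys <= sumn ys.
Proof.
elim: ys => [|y ys IH] //= H; have /andP[y0 ya] := H.
by have := IH ya; move: y0; rewrite /=; lia.
Qed.

End weighted_sum.

(* State at the end of slot [n]: [gap] is [n.+1] minus the last generation slot,
   [gaps] lists, oldest first, the differences of the generation slots of the
   last delivered packet and of the buffered ones, and [dev] is the sum of the
   first [n] ages minus [c * n].  The auxiliary [weight] is
   [\sum_(j <= n) beta ^+ (n.+1 - j) / z ^+ #arrivals in (j, n]]; it only serves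
   to bound the age. *)
Record state (R : Type) := State {
  channel : bool; gap : nat; gaps : seq nat; dev : R; weight : R }.

Definition age (R : Type) (st : state R) : nat := (sumn (gaps st) + gap st)%N.

(** * The Markov chain and a pathwise bound on the age *)

Section chain.
Context (R : realType) (c beta z : R).

Definition enqueue (ys : seq nat) (x : nat) (a : bool) : seq nat :=
  ys ++ (if a then [:: x] else [::]).

Definition serve (ys : seq nat) (s : bool) : seq nat :=
  if s then behead ys else ys.

Definition step (st : state R) (as_ : bool * bool) : state R :=
  let: (a, s) := as_ in
  {| channel := s;
     gap := if a then 1%N else (gap st).+1;
     gaps := serve (enqueue (gaps st) (gap st) a) s;
     dev := dev st + (age st)%:R - c;
     weight := beta * (1 + (if a then weight st / z else weight st)) |}.

(** The channel value is a placeholder, as slot 0 has no channel state. The gap 1 encodes a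
    fictitious packet generated and delivered in slot 0, in accordance with the convention of
    [fcfs_latest]. *)
Definition init_state : state R := State true 1 [::] 0 beta.

Definition run (l : seq (bool * bool)) : state R := foldl step init_state l.

Lemma run_rcons l x : run (rcons l x) = step (run l) x.
Proof. by rewrite /run foldl_rcons. Qed.

(** Let [j] be the generation slot of the last delivered packet ([i = 0]) or of the [i]-th buffered
    one. At the end of slot [n] the exponent of [beta] is [n.+1 - j], and [size (gaps st) - i]
    arrivals fall in [(j, n]]: each inequality bounds one term of the sum [weight] by the whole
    sum. *)
Definition age_bound (st : state R) : Prop :=
  [/\ all (ltn 0) (gaps st), (0 < gap st)%N, 0 <= weight st &
   forall i, (i <= size (gaps st))%N ->
    beta ^+ (gap st + sumn (drop i (gaps st))) <=
    z ^+ (size (gaps st) - i) * weight st].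

Lemma age_ge1 st : age_bound st -> (0 < age st)%N.
Proof. by case=> _ g0 _ _; rewrite /age addn_gt0 g0 orbT. Qed.

Lemma size_lt_age st : age_bound st -> (size (gaps st) < age st)%N.
Proof.
by case=> Y0 g0 _ _; rewrite /age; have := size_le_sumn Y0; lia.
Qed.

Lemma age_step st x : (age (step st x) <= (age st).+1)%N.
Proof.
case: x => a s; rewrite /age /=.
have H (ys : seq nat) : (sumn (serve ys s) <= sumn ys)%N.
  by case: s ys => [] // [|y ys] //=; lia.
apply: leq_trans (leq_add (H _) (leqnn _)) _.
by rewrite /enqueue sumn_cat; case: a => /=; lia.
Qed.

Lemma expr_age_le st : age_bound st -> beta ^+ age st <= z ^+ size (gaps st) * weight st.
Proof.
by case=> _ _ _ /(_ 0%N isT); rewrite drop0 subn0 addnC.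
Qed.

Hypotheses (b1 : 1 <= beta) (z1 : 1 <= z).

Lemma age_bound_step st x : age_bound st -> age_bound (step st x).
Proof.
have b0 : 0 < beta by exact: lt_le_trans b1.
have z0 : 0 < z by exact: lt_le_trans z1.
case: x => a s [Ypos gpos L0 HL].
(* A good slot only removes the head of [gaps], so its inequality at [i] is the one at [i.+1] for a
   bad slot. *)
suff : age_bound (step st (a, false)).
  case: s => // -[/= Y' g' L0' HL']; split => //=.
    by move: Y'; case: (enqueue _ _ _) => //= ? ? /andP[].
  case: (enqueue _ _ _) HL' => [|y ys] HL' /= i; first exact: HL'.
  by move=> iy; have := HL' i.+1; rewrite /= subSS; apply.
case: a; split => //=.
- by rewrite all_cat Ypos /= gpos.
- apply: mulr_ge0; first exact: ltW.
  by apply: addr_ge0 => //; apply: divr_ge0 => //; exact: ltW.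
- move=> i; rewrite /enqueue size_cat /= addn1 leq_eqVlt => /orP[/eqP ->|].
    rewrite subnn expr0 mul1r drop_oversize ?size_cat ?addn1 //= addn0 expr1.
    apply: ler_peMr; first exact: ltW.
    by rewrite lerDl; apply: divr_ge0 => //; exact: ltW.
  rewrite ltnS => iY; rewrite drop_cat.
  have -> : (if (i < size (gaps st))%N then drop i (gaps st) ++ [:: gap st]
     else drop (i - size (gaps st)) [:: gap st]) = drop i (gaps st) ++ [:: gap st].
    case: ltnP => // Yi.
    have -> : i = size (gaps st) by apply/eqP; rewrite eqn_leq iY Yi.
    by rewrite subnn drop_size.
  rewrite sumn_cat /= addn0 add1n [(_ + gap st)%N]addnC exprS subSn //.
  have /(ler_wpM2l (ltW b0))/le_trans := HL _ iY; apply.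
  rewrite exprS [X in _ <= X](_ : _ =
    beta * (z * z ^+ (size (gaps st) - i) + z ^+ (size (gaps st) - i) * weight st)); last first.
    by field; rewrite gt_eqF.
  apply: ler_wpM2l; first exact: ltW.
  by rewrite lerDr; apply: mulr_ge0; [exact: ltW|apply: exprn_ge0; exact: ltW].
- by rewrite /enqueue cats0.
- by apply: mulr_ge0; [exact: ltW|exact: addr_ge0].
- move=> i; rewrite /enqueue cats0 => iY; rewrite addSn exprS.
  have /(ler_wpM2l (ltW b0))/le_trans := HL _ iY; apply.
  rewrite mulrCA; apply: ler_wpM2l; first by apply: exprn_ge0; exact: ltW.
  by apply: ler_wpM2l; [exact: ltW|rewrite lerDr].
Qed.

Lemma age_bound_run l : age_bound (run l).
Proof.
elim/last_ind: l => [|l x IH]; last by rewrite run_rcons; exact: age_bound_step.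
split => //=; first exact: le_trans b1.
by move=> [|//] _; rewrite expr0 mul1r expr1.
Qed.

End chain.

(** * The Poisson equation for the full state *)

Section drift.
Context (R : realType) (p r lambda : R).
Hypotheses (hp : 0 < p < 1) (hr : 0 < r < 1).
Hypothesis (hl : 0 < lambda < r / (p + r)).
Local Notation tr := (GE_transition p r).
Local Notation c := (mean_age p r lambda).
Context (beta z : R).
Local Notation step := (step c beta z).

Definition next_mean (F : state R -> R) (st : state R) : R :=
  tr (channel st) true *
    (lambda * F (step st (true, true)) + (1 - lambda) * F (step st (false, true))) +
  tr (channel st) false *
    (lambda * F (step st (true, false)) + (1 - lambda) * F (step st (false, false))).

Lemma tr_ge0 x y : 0 <= tr x y.
Proof.
by move: hp hr => /andP[? ?] /andP[? ?]; case: x; case: y => /=; lra.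
Qed.

Lemma tr_sum x : tr x true + tr x false = 1.
Proof. by case: x => /=; ring. Qed.

Lemma lambda01 : 0 < lambda < 1.
Proof. by have [-> ->] := params hp hr hl. Qed.

Lemma next_mean_le F G st :
  (forall x, F (step st x) <= G (step st x)) -> next_mean F st <= next_mean G st.
Proof.
move=> FG; have /andP[l0 l1] := lambda01.
have l2 : 0 <= 1 - lambda by lra.
by apply: lerD; (apply: ler_wpM2l; first exact: tr_ge0);
  apply: lerD; (apply: ler_wpM2l; [lra|exact: FG]).
Qed.

(* Packet [k] of the buffer counts [gaps`_k] times, once for each slot in which
   it is the first packet still to be generated; likewise for [gap]. *)
Definition potential (st : state R) : R :=
  kappa p r * (wsum (gaps st))%:R + delta p r (channel st) * (sumn (gaps st))%:R +
  ((gap st)%:R - 1) * mean_wait p r lambda (channel st) (size (gaps st)) +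
  quad_corr p r lambda (channel st) (size (gaps st)).

#[local] Arguments delta : simpl never.

Lemma delta_rec s : tr s false * delta p r false - tr s true * kappa p r = delta p r s - 1.
Proof.
have /andP[r0 _] := hr; have rn : r != 0 by rewrite gt_eqF.
by case: s; rewrite /delta /kappa /=; field.
Qed.

(** Each slot counted by [gaps] loses one unit of waiting by [delta_rec]. The current slot joins
    those that wait for an arrival, so [mean_wait] enters [gap st] times instead of [gap st - 1];
    the right-hand side of [quad_corr_rec] absorbs the surplus and supplies [c]. *)
Lemma next_mean_potential st :
  next_mean potential st = potential st - (age st)%:R + c.
Proof.
have T := tr_sum (channel st).
rewrite /next_mean /potential /age /=.
have HE0 := quad_corr_rec0 hp hr hl (channel st).
have hE0 := mean_wait_rec0 hp hr hl (channel st).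
have HE := quad_corr_rec hp hr hl (channel st).
have hE := mean_wait_rec hp hr hl (channel st).
have D := delta_rec (channel st).
move: (channel st) (gap st) T HE0 hE0 HE hE D => s x T HE0 hE0 HE hE D.
rewrite /enqueue; case: (gaps st) => [|y ys] /=.
  rewrite !add0n !addn0 -!natr1; set X := x%:R.
  transitivity (X * (mean_wait p r lambda s 0 - 1) +
    (quad_corr p r lambda s 0 - mean_wait p r lambda s 0 + c)); last by ring.
  by rewrite -hE0 -HE0 (_ : delta p r true = 0) //; ring.
rewrite !cats0 !cats1 wsum_rcons !sumn_rcons !size_rcons.
set q := size ys; set S : R := y%:R + (sumn ys)%:R.
rewrite !(natrD, natrM) -?natr1.
move: (HE q) (hE q) => {}HE {}hE.
transitivity (x%:R * (mean_wait p r lambda s q.+1 - 1) +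
    (quad_corr p r lambda s q.+1 - mean_wait p r lambda s q.+1 + c) +
  kappa p r * (wsum ys)%:R + kappa p r * S + (delta p r s - 1) * S); last by rewrite /S; ring.
rewrite -hE -HE -D -?natr1 /S.
have -> : tr s true = 1 - tr s false by rewrite -T addrK.
rewrite (_ : delta p r true = 0) //; ring.
Qed.
End drift.

(** * Moment bounds *)

Section lyapunov.
Context (R : realType) (p r lambda : R).
Hypotheses (hp : 0 < p < 1) (hr : 0 < r < 1).
Hypothesis (hl : 0 < lambda < r / (p + r)).
Local Notation tr := (GE_transition p r).
Local Notation c := (mean_age p r lambda).

(* First-order perturbation of [z = 1], [w = 1]: stability provides a slope [v]
   of [w true] in [e = z - 1] for which both inequalities are strict. *)
Lemma queue_weights : exists (w : bool -> R) (z rho : R),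
  [/\ forall s, 0 < w s, 1 < z, 0 <= rho < 1 &
    forall s, (1 - lambda + lambda * z) * (tr s true * w true / z + tr s false * w false)
      <= rho * w s].
Proof.
have [l0 l1 h1 h2 h3] := params hp hr hl.
move: hp hr => /andP[p0 p1] /andP[r0 r1].
(* To first order the good state requires [v > (lambda - 1 + p) / p] and the bad state
   [v < (r - lambda) / r]. This interval is nonempty exactly when [(p + r) * lambda < r]; [v] is its
   midpoint. *)
pose v : R := ((lambda - 1 + p) / p + (r - lambda) / r) / 2.
have vE : (lambda - 1 + p) / p < (r - lambda) / r.
  rewrite ltr_pdivrMr // mulrAC ltr_pdivlMr //; nra.
have c1 : 0 < 1 - p - lambda + p * v.
  have : (lambda - 1 + p) / p < v by rewrite /v; lra.
  by rewrite ltr_pdivrMr //; lra.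
have c2 : 0 < r - lambda - r * v.
  have : v < (r - lambda) / r by rewrite /v; lra.
  by rewrite ltr_pdivlMr //; lra.
pose d := Num.min (1 - p - lambda + p * v) (r - lambda - r * v).
have d0 : 0 < d by rewrite lt_min c1 c2.
have dG : d <= 1 - p - lambda + p * v by rewrite ge_min lexx.
have dB : d <= r - lambda - r * v by rewrite ge_min lexx orbT.
have V0 : 0 <= `|v| by [].
have vle : - `|v| <= v <= `|v| by rewrite -ler_norml.
(* Chosen so that [e * (2 * (1 + |v|))] is less than both [d] and 1: the second-order remainder
   stays below the first-order gain [d], and [w true] stays positive. *)
pose e := d / (d + 1) / (2 * (1 + `|v|)).
have e0 : 0 < e by rewrite /e divr_gt0 ?divr_gt0 // ?mulr_gt0 //; lra.
have q1 : d / (d + 1) < 1 by rewrite ltr_pdivrMr ?mul1r //; lra.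
have qd : d / (d + 1) < d by rewrite ltr_pdivrMr ?ltr_pMr //; lra.
have eV : e * (2 * (1 + `|v|)) = d / (d + 1).
  by rewrite /e divfK // gt_eqF // mulr_gt0 //; lra.
have evd : e * (2 * `|v| + 1) < d by nra.
have ev1 : e * `|v| < 1 by nra.
pose w (s : bool) : R := if s then 1 + e * v else 1.
have w0 s : 0 < w s.
  case: s => //=; case/andP: vle => va _.
  have : e * - `|v| <= e * v by rewrite ler_pM2l.
  lra.
pose z := 1 + e.
have z1 : 1 < z by rewrite /z; lra.
pose f s := (1 - lambda + lambda * z) * (tr s true * w true / z + tr s false * w false).
have zf s : z * f s = (1 + lambda * e) * (tr s true * w true + tr s false * w false * z).
  rewrite /f /z; field; lra.
have bG : `|v - lambda * ((1 - p) * v + p)| <= 2 * `|v| + 1.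
  have := vle; rewrite ler_norml => /andP[va vb]; nra.
have bB : `|lambda * (r * v + 1 - r)| <= 2 * `|v| + 1.
  have := vle; rewrite ler_norml => /andP[va vb]; nra.
have fw s : f s < w s.
  have zp : 0 < z by lra.
  rewrite -(ltr_pM2l zp) zf -subr_gt0.
  case: s => /=.
    rewrite (_ : _ - _ =
      e * ((1 - p - lambda + p * v) + e * (v - lambda * ((1 - p) * v + p)))); last first.
      by rewrite /z /w; ring.
    apply: mulr_gt0 => //.
    move: bG; rewrite ler_norml => /andP[ba _].
    have : e * - (2 * `|v| + 1) <= e * (v - lambda * ((1 - p) * v + p)) by rewrite ler_pM2l.
    lra.
  rewrite (_ : _ - _ = e * ((r - lambda - r * v) - e * (lambda * (r * v + 1 - r)))); last first.
    by rewrite /z /w; ring.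
  apply: mulr_gt0 => //.
  move: bB; rewrite ler_norml => /andP[_ bb].
  have : e * (lambda * (r * v + 1 - r)) <= e * (2 * `|v| + 1) by rewrite ler_pM2l.
  lra.
have f0 s : 0 <= f s.
  have zp : 0 < z by lra.
  apply: mulr_ge0; first by rewrite /z; nra.
  apply: addr_ge0; last by apply: mulr_ge0; [exact: tr_ge0|exact: ltW].
  by apply: divr_ge0; [apply: mulr_ge0; [exact: tr_ge0|exact: ltW]|exact: ltW].
exists w, z, (Num.max (f true / w true) (f false / w false)); split => //.
  apply/andP; split.
    by rewrite le_max divr_ge0 // ltW.
  by rewrite gt_max !ltr_pdivrMr // !mul1r !fw.
move=> s; rewrite -/(f s) -ler_pdivrMr // le_max.
by case: s; rewrite lexx ?orbT.
Qed.

End lyapunov.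

(** With [a] the fourth root of [b], Bernoulli's inequality gives [n * (a - 1) <= a ^+ n]; raise it
    to the fourth power. *)
Lemma pow4_le_expr (R : realType) (b : R) : 1 < b ->
  exists2 C : R, 0 <= C & forall n : nat, n%:R ^+ 4 <= C * b ^+ n.
Proof.
move=> b1; have b0 : 0 <= b by lra.
pose a := Num.sqrt (Num.sqrt b).
have a4 : a ^+ 4 = b by rewrite (exprM a 2 2) !sqr_sqrtr ?sqrtr_ge0.
have a1 : 1 < a.
  by rewrite -(@ltr_pXn2r _ 4) ?nnegrE ?sqrtr_ge0 // a4 expr1n.
have e0 : 0 < a - 1 by lra.
exists ((a - 1) ^- 4); first by rewrite invr_ge0 exprn_ge0 // ltW.
move=> n; rewrite mulrC ler_pdivlMr ?exprn_gt0 // -a4 -exprM mulnC exprM -exprMn.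
have H : n%:R * (a - 1) <= a ^+ n.
  elim: n => [|n IH]; first by rewrite mul0r.
  have : 1 <= a ^+ n by rewrite exprn_ege1 // ltW.
  rewrite exprS -natr1; nra.
by rewrite lerXn2r ?nnegrE // ?mulr_ge0 ?exprn_ge0 //; lra.
Qed.

Section lyapunov_drift.
Context (R : realType) (p r lambda : R).
Hypotheses (hp : 0 < p < 1) (hr : 0 < r < 1).
Hypothesis (hl : 0 < lambda < r / (p + r)).
Local Notation tr := (GE_transition p r).
Local Notation c := (mean_age p r lambda).
Context (w : bool -> R) (z rho beta : R).
Hypotheses (w0 : forall s, 0 < w s) (z1 : 1 < z) (rho01 : 0 <= rho < 1).
Hypothesis hw : forall s, (1 - lambda + lambda * z) *
  (tr s true * w true / z + tr s false * w false) <= rho * w s.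
Hypotheses (b1 : 1 < beta) (hb : beta * (1 - lambda + lambda / z) < 1).
Local Notation step := (step c beta z).
Local Notation next_mean := (next_mean p r lambda beta z).
Local Notation potential := (potential p r lambda).
Local Notation age_bound := (age_bound beta z).

Definition queue_weight (st : state R) : R := w (channel st) * z ^+ size (gaps st).

Lemma queue_weight_gt0 st : 0 < queue_weight st.
Proof. by rewrite mulr_gt0 // exprn_gt0 // (lt_trans ltr01). Qed.

(** For a nonempty queue this is [hw] multiplied by a power of [z]. The constant pays for the empty
    queue, which a good slot cannot shorten. *)
Lemma queue_weight_drift : exists2 b : R, 0 <= b &
  forall st, next_mean queue_weight st <= rho * queue_weight st + b.
Proof.
have /andP[l0 l1] := lambda01 hp hr hl.
have /andP[r0 _] := rho01.
have z0 : 0 < z by exact: lt_trans z1.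
exists (w true + w false * z).
  by apply: addr_ge0; [exact: ltW|apply: mulr_ge0; exact: ltW].
move=> st; rewrite /next_mean /queue_weight /=.
have T1 x y := tr_ge0 hp hr x y.
have T := tr_sum p r (channel st).
have wt := w0 true; have wf := w0 false.
have H := hw (channel st); have ws := w0 (channel st).
rewrite /enqueue; case: (gaps st) => [|y ys] /=.
  rewrite !expr0 expr1 !mulr1.
  have t1 := T1 (channel st) true; have t2 := T1 (channel st) false.
  have : 0 <= rho * w (channel st) by apply: mulr_ge0 => //; exact: ltW.
  have : tr (channel st) true * w true <= w true by rewrite ler_piMl //; lra.
  have X : lambda * (w false * z) + (1 - lambda) * w false <= w false * z.
    have : 0 <= (1 - lambda) * (w false * (z - 1)).
      by apply: mulr_ge0; [lra|apply: mulr_ge0; [exact: ltW|rewrite subr_ge0; exact: ltW]].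
    lra.
  have : tr (channel st) false * (lambda * (w false * z) + (1 - lambda) * w false) <= w false * z.
    apply: le_trans (ler_wpM2l t2 X) _.
    apply: ler_piMl; last lra.
    by apply: mulr_ge0; exact: ltW.
  lra.
rewrite !cats0 !cats1 !size_rcons !exprS; set q := z ^+ size ys.
have q0 : 0 <= q by apply: exprn_ge0; exact: ltW.
have : z * q * ((1 - lambda + lambda * z) *
  (tr (channel st) true * w true / z + tr (channel st) false * w false)) <=
  z * q * (rho * w (channel st)).
  by apply: ler_wpM2l => //; apply: mulr_ge0 => //; exact: ltW.
rewrite (_ : z * q * ((1 - lambda + lambda * z) *
  (tr (channel st) true * w true / z + tr (channel st) false * w false)) =
  (1 - lambda + lambda * z) * q *
  (tr (channel st) true * w true + tr (channel st) false * w false * z)); last first.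
  by field; rewrite gt_eqF.
have : 0 <= w false * z by apply: mulr_ge0; exact: ltW.
lra.
Qed.

Definition lyap (st : state R) : R := queue_weight st + weight st.

(** The two components contract separately: [queue_weight] with factor [rho], and [weight] with
    factor [beta * (1 - lambda + lambda / z)], which is below 1 by [hb]. *)
Lemma lyap_drift : exists rho' b : R, [/\ 0 <= rho' < 1, 0 <= b &
  forall st, 0 <= weight st -> next_mean lyap st <= rho' * lyap st + b].
Proof.
have [b b0 hU] := queue_weight_drift.
have /andP[l0 l1] := lambda01 hp hr hl.
have z0 : 0 < z by exact: lt_trans z1.
have lz : 0 < lambda / z by exact: divr_gt0.
exists (Num.max rho (beta * (1 - lambda + lambda / z))), (b + beta); split.
- have /andP[? ?] := rho01.
  by rewrite le_max gt_max; apply/andP; split; [apply/orP; left|apply/andP].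
- by have := b1; lra.
move=> st L0.
have T := tr_sum p r (channel st).
have -> : next_mean lyap st = next_mean queue_weight st +
    beta * (1 + (1 - lambda + lambda / z) * weight st).
  rewrite /next_mean /lyap /=.
  have -> : tr (channel st) true = 1 - tr (channel st) false by lra.
  ring.
have := hU st; rewrite /lyap; set m := Num.max _ _ => H.
have m1 : rho <= m by rewrite le_max lexx.
have m2 : beta * (1 - lambda + lambda / z) <= m by rewrite le_max lexx orbT.
have U0 := queue_weight_gt0 st.
have := ler_wpM2r (ltW U0) m1; have := ler_wpM2r L0 m2.
lra.
Qed.

Lemma lyap_ge0 st : age_bound st -> 0 <= lyap st.
Proof. by case=> _ _ L0 _; apply: addr_ge0 => //; exact/ltW/queue_weight_gt0. Qed.

(** By [expr_age_le], [beta ^+ age st] is at most a constant times [queue_weight st * weight st],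
    hence at most a constant times [lyap st ^+ 2]. Thus powers of the square root of [beta] are
    controlled by [lyap] itself, and they dominate the fourth power of the age. *)
Lemma age_pow4_le : exists2 C : R, 0 <= C &
  forall st, age_bound st -> (age st)%:R ^+ 4 <= C * lyap st.
Proof.
have z0 : 0 < z by exact: lt_trans z1.
have b0 : 0 <= beta by have := b1; lra.
pose b := Num.sqrt beta.
have bE : b ^+ 2 = beta by rewrite sqr_sqrtr.
have bg : 0 <= b by exact: sqrtr_ge0.
have bgt1 : 1 < b by rewrite -(@ltr_pXn2r _ 2) ?nnegrE // bE expr1n.
have [C C0 HC] := pow4_le_expr bgt1.
pose m := 1 + (w true)^-1 + (w false)^-1.
have i0 s : 0 < (w s)^-1 by rewrite invr_gt0.
have m0 : 0 < m by have := i0 true; have := i0 false; rewrite /m; lra.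
exists (C * m); first by apply: mulr_ge0 => //; exact: ltW.
move=> st I; have [_ _ L0 _] := I.
have E := expr_age_le I.
apply: le_trans (HC _) _; rewrite -mulrA; apply: ler_wpM2l => //.
have U0 := queue_weight_gt0 st.
have zU : z ^+ size (gaps st) <= m * queue_weight st.
  rewrite /queue_weight mulrA ler_peMl ?exprn_ge0 ?(ltW z0) //.
  rewrite -ler_pdivrMr // mul1r /m.
  by have := i0 true; have := i0 false; case: (channel st); lra.
have m1 : 1 <= m by have := i0 true; have := i0 false; rewrite /m; lra.
have y0 : 0 <= m * lyap st.
  by apply: mulr_ge0; [exact: ltW|exact: lyap_ge0].
rewrite -(@ler_pXn2r _ 2) ?nnegrE ?exprn_ge0 //.
rewrite exprAC bE; apply: le_trans E _.
apply: le_trans (ler_wpM2r L0 zU) _; rewrite /lyap.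
set U := queue_weight st in U0 *; set L := weight st in L0 *.
have x0 : 0 <= m * U by apply: mulr_ge0; exact: ltW.
have x1 : L <= m * L by rewrite ler_peMl.
have x2 : m * U * L <= m * U * (m * L) by exact: ler_wpM2l.
have x3 : 0 <= m * L by apply: mulr_ge0 => //; exact: ltW.
have x4 : 0 <= m * U * (m * L) by exact: mulr_ge0.
have := sqr_ge0 (m * U); have := sqr_ge0 (m * L).
rewrite mulrDr sqrrD !mulr2n; lra.
Qed.

Lemma mean_wait_bound : exists2 C : R, 0 <= C &
  forall s q, `|mean_wait p r lambda s q| <= C * q.+1%:R.
Proof.
have t0 := ltW (theta_gt0 hp hr hl); have t1 := ltW (theta_lt1 hp hr hl).
pose C (s : bool) : R := `|kappa p r| + `|delta p r s| + `|gamma p r lambda s|.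
have C0 s : 0 <= C s by rewrite !addr_ge0.
exists (C true + C false); first by rewrite addr_ge0.
move=> s q; apply: (@le_trans _ _ (C s * q.+1%:R)); last first.
  apply: ler_wpM2r => //; case: s; first by rewrite lerDl.
  by rewrite lerDr.
have n1 : 1 <= q.+1%:R :> R by rewrite ler1n.
rewrite /mean_wait /C !mulrDl; apply: le_trans (ler_normD _ _) _; apply: lerD.
  apply: le_trans (ler_normD _ _) _; apply: lerD; first by rewrite normrM normr_nat.
  by rewrite ler_peMr.
rewrite normrM; apply: ler_wpM2l => //; apply: le_trans n1.
by rewrite normrX ger0_norm // exprn_ile1.
Qed.

Lemma quad_corr_bound : exists2 C : R, 0 <= C &
  forall s q, `|quad_corr p r lambda s q| <= C * q.+1%:R ^+ 2.
Proof.
have t0 := ltW (theta_gt0 hp hr hl); have t1 := ltW (theta_lt1 hp hr hl).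
pose C (s : bool) : R := `|alpha p r lambda| + `|mu_coef p r lambda s| + `|nu_coef p r lambda s|
  + `|eta_coef p r lambda s|.
have C0 s : 0 <= C s by rewrite !addr_ge0.
exists (C true + C false); first by rewrite addr_ge0.
move=> s q; apply: (@le_trans _ _ (C s * q.+1%:R ^+ 2)); last first.
  apply: ler_wpM2r; first exact: exprn_ge0.
  by case: s; rewrite ?lerDl ?lerDr.
have n0 : 1 <= q.+1%:R :> R by rewrite ler1n.
have n1 : 1 <= q.+1%:R ^+ 2 :> R by exact: exprn_ege1.
have n2 : q%:R <= q.+1%:R :> R by rewrite ler_nat.
have n3 : q.+1%:R <= q.+1%:R ^+ 2 :> R by rewrite expr2 ler_peMl.
rewrite /quad_corr /C.
move: (alpha _ _ _) (mu_coef _ _ _ _) (nu_coef _ _ _ _) (eta_coef _ _ _ _) => a1 a2 a3 a4.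
rewrite !mulrDl; apply: le_trans (ler_normD _ _) _; apply: lerD; last first.
  rewrite normrM; apply: ler_wpM2l => //; apply: le_trans n1.
  by rewrite normrX ger0_norm // exprn_ile1.
apply: le_trans (ler_normD _ _) _; apply: lerD; last by rewrite ler_peMr.
apply: le_trans (ler_normD _ _) _; apply: lerD; rewrite normrM; apply: ler_wpM2l => //.
  by rewrite normrX normr_nat lerXn2r ?nnegrE.
by rewrite normr_nat; exact: le_trans n3.
Qed.

(** Quadratic growth in the age is why the variance of the martingale increments calls for a fourth
    moment. *)
Lemma potential_bound : exists2 C : R, 0 <= C &
  forall st, age_bound st -> `|potential st| <= C * (age st)%:R ^+ 2.
Proof.
have [C1 C10 H1] := mean_wait_bound; have [C2 C20 H2] := quad_corr_bound.
pose C3 : R := `|kappa p r| + (`|delta p r true| + `|delta p r false|) + C1 + C2.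
exists C3; first by rewrite !addr_ge0.
move=> st I; have a1 := age_ge1 I; have qa := size_lt_age I.
have [_ g0 _ _] := I.
have distr (u1 u2 u3 u4 v : R) :
    (u1 + u2 + u3 + u4) * v = u1 * v + u2 * v + u3 * v + u4 * v by ring.
rewrite /potential /C3 distr.
have sa : (sumn (gaps st))%:R <= (age st)%:R :> R by rewrite ler_nat leq_addr.
have na : 1 <= (age st)%:R :> R by rewrite ler1n.
have qaR : (size (gaps st)).+1%:R <= (age st)%:R :> R by rewrite ler_nat.
have aa : (age st)%:R <= (age st)%:R ^+ 2 :> R by rewrite expr2 ler_peMl.
apply: le_trans (ler_normD _ _) _; apply: lerD; last first.
  apply: le_trans (H2 _ _) _; apply: ler_wpM2l => //.
  by rewrite lerXn2r ?nnegrE.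
apply: le_trans (ler_normD _ _) _; apply: lerD; last first.
  rewrite normrM; apply: le_trans (ler_wpM2l (normr_ge0 _) (H1 _ _)) _.
  rewrite mulrCA; apply: ler_wpM2l => //; rewrite expr2; apply: ler_pM => //.
  have g1 : 1 <= (gap st)%:R :> R by rewrite ler1n.
  rewrite ger0_norm ?subr_ge0 //; apply: (@le_trans _ _ (gap st)%:R).
    by rewrite gerBl.
  by rewrite ler_nat leq_addl.
apply: le_trans (ler_normD _ _) _; apply: lerD.
  rewrite normrM normr_nat; apply: ler_wpM2l => //.
  rewrite -natrX ler_nat; apply: leq_trans (wsum_le _) _.
  by rewrite expnS expn1 leq_mul // ?leq_addr // ltnW.
rewrite normrM normr_nat; apply: ler_pM => //; last exact: le_trans aa.
by case: (channel st); rewrite ?lerDl ?lerDr.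
Qed.

Definition deviation (st : state R) : R := dev st + potential st.

(** The Poisson equation makes the increment of [deviation] centred, so the cross term vanishes; the
    squared increment is of order [age ^+ 4], which [lyap] controls. *)
Lemma deviation_variance : exists2 C : R, 0 <= C & forall st, age_bound st ->
  next_mean (fun st => deviation st ^+ 2) st <= deviation st ^+ 2 + C * lyap st.
Proof.
have [C1 C10 H1] := age_pow4_le; have [C2 C20 H2] := potential_bound.
(* The factor 4 comes from squaring a sum of four terms. The 17 is 1 for the old potential plus 16
   for the new one, since the age at most doubles and the potential is quadratic in it. *)
pose C3 : R := 4 * (1 + c ^+ 2 + 17 * C2 ^+ 2).
have C30 : 0 <= C3 by rewrite /C3; have := sqr_ge0 c; have := sqr_ge0 C2; lra.
exists (C3 * C1); first exact: mulr_ge0.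
move=> st I.
have a1 : 1 <= (age st)%:R :> R by rewrite ler1n (age_ge1 I).
pose D x : R := (age st)%:R - c + potential (step st x) - potential st.
have DE x : deviation (step st x) = deviation st + D x.
  by case: x => a s; rewrite /deviation /D /=; ring.
have DB x : D x ^+ 2 <= C3 * (age st)%:R ^+ 4.
  have I' : age_bound (step st x) by apply: age_bound_step => //; exact: ltW.
  have B := H2 _ I; have B' := H2 _ I'.
  set A := (age st)%:R in a1 B *; set A' := (age _)%:R in B'.
  have A'2 : A' <= 2 * A.
    rewrite -natrM ler_nat; apply: leq_trans (age_step _ _ _ _ _) _.
    by rewrite mul2n -addnn -addn1 leq_add2l (age_ge1 I).
  have q1 : potential st ^+ 2 <= C2 ^+ 2 * A ^+ 4.
    rewrite (exprM A 2 2) -exprMn -[_ ^+ 2]ger0_norm ?sqr_ge0 // normrX.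
    by rewrite lerXn2r ?nnegrE // mulr_ge0 ?sqr_ge0.
  have q2 : potential (step st x) ^+ 2 <= 16 * C2 ^+ 2 * A ^+ 4.
    have A'4 : A' ^+ 2 <= 4 * A ^+ 2.
      have -> : 4 * A ^+ 2 = (2 * A) ^+ 2 by ring.
      by rewrite lerXn2r ?nnegrE // mulr_ge0.
    have -> : 16 * C2 ^+ 2 * A ^+ 4 = (C2 * (4 * A ^+ 2)) ^+ 2 by ring.
    rewrite -[_ ^+ 2]ger0_norm ?sqr_ge0 // normrX.
    rewrite lerXn2r ?nnegrE ?mulr_ge0 ?sqr_ge0 //.
    by apply: le_trans B' _; exact: ler_wpM2l.
  have A2 : A ^+ 2 <= A ^+ 4 by rewrite ler_weXn2l.
  have A4 : 1 <= A ^+ 4 by exact: exprn_ege1.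
  have q3 : c ^+ 2 <= c ^+ 2 * A ^+ 4 by rewrite ler_peMr ?sqr_ge0.
  have four (a b e f : R) : (a - b + e - f) ^+ 2 <= 4 * (a ^+ 2 + b ^+ 2 + e ^+ 2 + f ^+ 2).
    have := sqr_ge0 (a + b); have := sqr_ge0 (a - e); have := sqr_ge0 (a + f).
    have := sqr_ge0 (b + e); have := sqr_ge0 (b - f); have := sqr_ge0 (e + f).
    rewrite !expr2; lra.
  rewrite /D -/A; apply: le_trans (four _ _ _ _) _; rewrite /C3; lra.
have DM : next_mean (fun st' => deviation st' - deviation st) st = 0.
  have P := next_mean_potential hp hr hl beta z st.
  have T := tr_sum p r (channel st).
  transitivity (next_mean potential st - potential st + (age st)%:R - c); last first.
    by rewrite P; ring.
  rewrite /next_mean /deviation /= -/potential.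
  have -> : tr (channel st) true = 1 - tr (channel st) false by rewrite -T addrK.
  ring.
have l01 := lambda01 hp hr hl; have /andP[l0 l1] := l01.
have T1 x y := tr_ge0 hp hr x y.
have T := tr_sum p r (channel st).
have -> : next_mean (fun st' => deviation st' ^+ 2) st =
   deviation st ^+ 2 + 2 * deviation st * next_mean (fun st' => deviation st' - deviation st) st
   + next_mean (fun st' => (deviation st' - deviation st) ^+ 2) st.
  rewrite /next_mean.
  have -> : tr (channel st) true = 1 - tr (channel st) false by rewrite -T addrK.
  ring.
rewrite DM mulr0 addr0 lerD2l -mulrA.
apply: le_trans (ler_wpM2l C30 (H1 _ I)).
have -> : C3 * (age st)%:R ^+ 4 = next_mean (fun=> C3 * (age st)%:R ^+ 4) st.
  rewrite /next_mean.
  have -> : tr (channel st) true = 1 - tr (channel st) false by rewrite -T addrK.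
  ring.
by apply: next_mean_le => // x; rewrite DE addrAC subrr add0r.
Qed.

Lemma dev_sqr_le : exists2 C : R, 0 <= C & forall st, age_bound st ->
  dev st ^+ 2 <= 2 * deviation st ^+ 2 + C * lyap st.
Proof.
have [C1 C10 H1] := age_pow4_le; have [C2 C20 H2] := potential_bound.
exists (2 * C2 ^+ 2 * C1); first by rewrite !mulr_ge0 ?sqr_ge0.
move=> st I.
have q1 : potential st ^+ 2 <= C2 ^+ 2 * (age st)%:R ^+ 4.
  rewrite (exprM _ 2 2) -exprMn -[_ ^+ 2]ger0_norm ?sqr_ge0 // normrX.
  by rewrite lerXn2r ?nnegrE ?mulr_ge0 ?sqr_ge0 // H2.
have q2 := ler_wpM2l (sqr_ge0 C2) (H1 _ I).
have -> : dev st = deviation st - potential st by rewrite /deviation addrK.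
have := sqr_ge0 (deviation st + potential st).
rewrite !expr2 in q1 q2 *; lra.
Qed.
End lyapunov_drift.

(** * The sample paths and the law of the histories *)

Section sample_path.
Context (R : realType) (c beta z : R) (a s : nat -> bool).
Local Notation run := (run c beta z).

Definition history (n : nat) : seq (bool * bool) :=
  [seq (a t, s t) | t <- iota 1 n].

Lemma historyS n : history n.+1 = rcons (history n) (a n.+1, s n.+1).
Proof.
have E : iota 1 n.+1 = rcons (iota 1 n) n.+1.
  by rewrite -[in LHS](addn1 n) iotaD cats1.
by rewrite /history E map_rcons.
Qed.

Lemma fcfs_latestS n :
  fcfs_latest a s n.+2 = maxn (fcfs_latest a s n.+1) (odflt 0%N (fcfs_delivered a s n.+1)).
Proof. by rewrite /fcfs_latest big_nat_recr. Qed.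

(** [u] and [b] both describe the end of slot [n]. As [u :: b] is strictly increasing, the packet
    delivered next exceeds all earlier ones, so the maximum in [fcfs_latest] is simply the last
    delivery. *)
Lemma run_history n (u := fcfs_latest a s n.+1) (b := backlog a s n) :
  [/\ path ltn u b, (last u b <= n)%N,
      gaps (run (history n)) = pairmap (fun x y => y - x)%N u b &
      gap (run (history n)) = (n.+1 - last u b)%N].
Proof.
rewrite /u /b {u b}; elim: n => [|n [IH1 IH2 IH3 IH4]].
  by rewrite /fcfs_latest big_geq.
rewrite historyS run_rcons fcfs_latestS /= IH3 IH4 /enqueue /fcfs_delivered /buffer /=.
move: (fcfs_latest a s n.+1) (backlog a s n) IH1 IH2 {IH3 IH4} => u b pu lu.
pose b' := b ++ (if a n.+1 then [:: n.+1] else [::]).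
have pu' : path ltn u b'.
  rewrite cat_path pu /=; case: (a n.+1) => //=; rewrite andbT; exact: leq_ltn_trans lu _.
have lu' : (last u b' <= n.+1)%N.
  by rewrite last_cat; case: (a n.+1) => //=; exact: leq_trans lu _.
have gE : (if a n.+1 then 1 else (n.+1 - last u b).+1)%N = (n.+2 - last u b')%N.
  by rewrite last_cat; case: (a n.+1) => /=; lia.
have -> : pairmap (fun x y => y - x)%N u b ++
    (if a n.+1 then [:: (n.+1 - last u b)%N] else [::]) = pairmap (fun x y => y - x)%N u b'.
  by rewrite pairmap_cat; case: (a n.+1).
rewrite gE -/b'; case: (s n.+1) => /=; last by rewrite maxn0.
case: b' pu' lu' {gE} => [|y b'] /=; first by rewrite maxn0.
by move=> /andP[uy py] ly; rewrite (maxn_idPr (ltnW uy)).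
Qed.

Lemma sumn_pairmap_sub u b : path ltn u b ->
  (sumn (pairmap (fun x y => y - x)%N u b) + u = last u b)%N.
Proof.
by elim: b u => [|y b IH] u //= /andP[uy /IH <-]; lia.
Qed.

Lemma age_run_history n : (age (run (history n)))%:R = fcfs_age a s R n.+1.
Proof.
have [pu lu gE xE] := run_history n.
rewrite /age gE xE /fcfs_age.
have H := sumn_pairmap_sub pu.
have ul : (fcfs_latest a s n.+1 <= n.+1)%N by lia.
rewrite -natrB //; congr (_%:R); lia.
Qed.

Lemma dev_run_history n :
  dev (run (history n)) = \sum_(1 <= t < n.+1) fcfs_age a s R t - c * n%:R.
Proof.
elim: n => [|n IH]; first by rewrite big_geq // mulr0 subr0.
rewrite historyS run_rcons big_nat_recr //= IH age_run_history -(natr1 n); ring.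
Qed.

End sample_path.

(** * The law of the finite histories *)

Section law.
Context (R : realType) (d : measure_display) (T : measurableType d)
  (P : probability T R) (p r lambda : R) (S A : nat -> {RV P >-> bool}).
Hypotheses (hS : GE_channel p r S) (hA : bernoulli_arrivals lambda A)
  (hAS : independent_processes slots A S).
Local Notation tr := (GE_transition p r).

Definition slot_range (n : nat) : {fset nat} := [fset i in iota 1 n]%fset.

Definition agree (X : nat -> {RV P >-> bool}) (n : nat) (x : nat -> bool) : set T :=
  [set w | forall t, (0 < t <= n)%N -> X t w = x t].

Lemma mem_slot_range n t : (t \in slot_range n) = (0 < t <= n)%N.
Proof. by rewrite !inE mem_iota; lia. Qed.

Lemma agreeE X n x :
  agree X n x = \bigcap_(i in [set` slot_range n]) (X i @^-1` [set x i]).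
Proof.
apply/seteqP; split => w H t /=.
  by rewrite mem_slot_range; exact: H.
by move=> tn; apply: H; rewrite /= mem_slot_range.
Qed.

Lemma measurable_preimage_bool (X : {RV P >-> bool}) b : measurable (X @^-1` [set b]).
Proof. by rewrite -[X in measurable X]setTI; exact: measurable_funP. Qed.

Lemma measurable_agree X n x : measurable (agree X n x).
Proof.
rewrite agreeE; apply: fin_bigcap_measurable; first exact: finite_fset.
by move=> i _; exact: measurable_preimage_bool.
Qed.

Lemma prob_arrival t b : (0 < t)%N ->
  P (A t @^-1` [set b]) = (if b then lambda else 1 - lambda)%:E.
Proof.
move=> t0; have [H _] := hA.
have Ht : P (A t @^-1` [set true]) = lambda%:E by exact: H.
case: b => //.
have -> : A t @^-1` [set false] = ~` (A t @^-1` [set true]).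
  by apply/seteqP; split => w /=; case: (A t w) => //; exact: absurd.
rewrite probability_setC; last exact: measurable_preimage_bool.
by rewrite Ht.
Qed.

Lemma slot_range_sub n : [set` slot_range n] `<=` slots.
Proof. by move=> t /=; rewrite mem_slot_range => /andP[]. Qed.

Lemma prob_agree_arrivals n x :
  P (agree A n.+1 x) =
  (P (agree A n x) * (if x n.+1 then lambda else 1 - lambda)%:E)%E.
Proof.
have [_ HI] := hA.
rewrite !agreeE !(HI _ (fun i => [set x i])) //; try exact: slot_range_sub.
have -> : slot_range n.+1 = (n.+1 |` slot_range n)%fset.
  by apply/fsetP => t; rewrite in_fset1U !mem_slot_range; lia.
rewrite big_fsetU1 /=; last by rewrite mem_slot_range; lia.
by rewrite muleC prob_arrival.
Qed.

Definition joint n (x y : nat -> bool) := agree A n x `&` agree S n y.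

(** Independence factors both sides, and each process then advances by one slot. The case [n = 0] is
    excluded because the law of the first channel state is arbitrary. *)
Lemma prob_joint n x y : (0 < n)%N ->
  P (joint n.+1 x y) =
  (P (joint n x y) * ((if x n.+1 then lambda else 1 - lambda) * tr (y n) (y n.+1))%:E)%E.
Proof.
move=> n0.
have I m : P (joint m x y) = (P (agree A m x) * P (agree S m y))%E.
  by rewrite /joint !agreeE hAS //; exact: slot_range_sub.
rewrite !I prob_agree_arrivals (hS _ n0) EFinM.
by rewrite muleACA.
Qed.

Definition hist (n : nat) (w : T) : seq (bool * bool) := history (A ^~ w) (S ^~ w) n.

Definition arrival_of (l : seq (bool * bool)) (t : nat) : bool := (nth (true, true) l t.-1).1.
Definition channel_of (l : seq (bool * bool)) (t : nat) : bool := (nth (true, true) l t.-1).2.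

Lemma hist_eqE n l : size l = n ->
  [set w | hist n w = l] = joint n (arrival_of l) (channel_of l).
Proof.
move=> sl; apply/seteqP; split => w /=.
  move=> <-; split => t /andP[t0 tn]; rewrite /arrival_of /channel_of /hist /history;
  by rewrite (nth_map 0%N) ?size_iota ?nth_iota ?add1n ?prednK //; lia.
move=> [HA HS]; apply: (@eq_from_nth _ (true, true)); rewrite size_map size_iota //.
move=> i iN; rewrite (nth_map 0%N) ?size_iota // nth_iota // add1n.
have iN' : (0 < i.+1 <= n)%N by [].
by rewrite (HA _ iN') (HS _ iN') /arrival_of /channel_of /=; case: (nth _ _ _).
Qed.

Lemma measurable_hist n l : measurable [set w | hist n w = l].
Proof.
have [/hist_eqE ->|sl] := eqVneq (size l) n.
  by apply: measurableI; exact: measurable_agree.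
rewrite (_ : [set w | _] = set0); first exact: measurable0.
apply/seteqP; split => // w /= E; move: sl.
by rewrite -E /hist /history size_map size_iota eqxx.
Qed.

Definition hist_mass n l : R := fine (P [set w | hist n w = l]).

Lemma hist_mass_ge0 n l : 0 <= hist_mass n l.
Proof. exact/fine_ge0/measure_ge0. Qed.

Lemma hist_massE n l : P [set w | hist n w = l] = (hist_mass n l)%:E.
Proof. by rewrite fineK // fin_num_measure //; exact: measurable_hist. Qed.

Lemma hist_mass_rcons n l x : (0 < n)%N -> size l = n ->
  hist_mass n.+1 (rcons l x) =
  hist_mass n l * ((if x.1 then lambda else 1 - lambda) * tr (channel_of l n) x.2).
Proof.
move=> n0 sl; apply: EFin_inj; rewrite EFinM -!hist_massE.
rewrite !hist_eqE ?size_rcons ?sl // prob_joint //.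
have N t : (t <= n)%N -> (0 < t)%N -> nth (true, true) (rcons l x) t.-1 = nth (true, true) l t.-1.
  by move=> tn t0; rewrite nth_rcons sl; case: ltnP => //; lia.
have Nx : nth (true, true) (rcons l x) n = x by rewrite nth_rcons sl ltnn eqxx.
rewrite /channel_of /arrival_of /= Nx N //.
congr (P _ * _)%E; rewrite /joint.
by congr (_ `&` _); apply/seteqP; split => w H t /andP[t0 tn];
  have := H t; rewrite t0 tn => /(_ isT) ->; rewrite N.
Qed.

Fixpoint hists (n : nat) : seq (seq (bool * bool)) :=
  if n is n'.+1 then
    [seq rcons l x | l <- hists n',
                     x <- [:: (true, true); (false, true); (true, false); (false, false)]]
  else [:: [::]].

Lemma size_hists n l : l \in hists n -> size l = n.
Proof.
elim: n l => [|n IH] l; first by rewrite inE => /eqP ->.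
by move=> /allpairsP[[l' x] /= [/IH sl _ ->]]; rewrite size_rcons sl.
Qed.

Lemma mem_hists n w : hist n w \in hists n.
Proof.
elim: n => [|n IH]; first by rewrite inE.
rewrite /hist historyS; apply/allpairsP; exists (hist n w, (A n.+1 w, S n.+1 w)).
by split => //=; case: (A n.+1 w); case: (S n.+1 w).
Qed.

(** The expectation of [g] over histories of length [n], as a finite sum, so that no integral over
    [T] has to be handled. *)
Definition hist_mean (n : nat) (g : seq (bool * bool) -> R) : R :=
  \sum_(l <- hists n) hist_mass n l * g l.

Lemma ler_hist_mean n g h : (forall l, g l <= h l) -> hist_mean n g <= hist_mean n h.
Proof. by move=> gh; apply: ler_sum => l _; apply: ler_wpM2l => //; exact: hist_mass_ge0. Qed.

Lemma hist_meanD n g h : hist_mean n (fun l => g l + h l) = hist_mean n g + hist_mean n h.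
Proof. by rewrite /hist_mean -big_split; apply: eq_bigr => l _; rewrite mulrDr. Qed.

Lemma hist_meanZ n k g : hist_mean n (fun l => k * g l) = k * hist_mean n g.
Proof. by rewrite /hist_mean mulr_sumr; apply: eq_bigr => l _; rewrite mulrCA. Qed.

Lemma hist_mean_ge0 n g : (forall l, 0 <= g l) -> 0 <= hist_mean n g.
Proof. by move=> g0; apply: sumr_ge0 => l _; apply: mulr_ge0 => //; exact: hist_mass_ge0. Qed.

(** The Markov property: given a history, the law of the next pair depends only on its last channel
    state. For [n > 0] the field [channel] holds this state and not the placeholder of
    [init_state]. *)
Lemma hist_mean_run beta z (F : state R -> R) n : (0 < n)%N ->
  hist_mean n.+1 (fun l => F (run (mean_age p r lambda) beta z l)) =
  hist_mean n (fun l => next_mean p r lambda beta z F (run (mean_age p r lambda) beta z l)).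
Proof.
move=> n0; rewrite /hist_mean.
have -> : hists n.+1 = [seq rcons l x | l <- hists n,
    x <- [:: (true, true); (false, true); (true, false); (false, false)]] by [].
rewrite big_allpairs_dep big_seq [RHS]big_seq.
apply: eq_bigr => l /size_hists sl.
rewrite !big_cons big_nil !hist_mass_rcons // !run_rcons /next_mean.
have -> : channel (run (mean_age p r lambda) beta z l) = channel_of l n.
  case/lastP: l sl => [|l x]; first by move=> n0'; rewrite -n0' in n0.
  rewrite size_rcons run_rcons /channel_of => <- /=.
  by rewrite nth_rcons ltnn eqxx; case: x.
rewrite /=; ring.
Qed.

Lemma prob_hist_le n (B : pred (seq (bool * bool))) :
  (P [set w | B (hist n w)] <= (\sum_(l <- hists n | B l) hist_mass n l)%:E)%E.
Proof.
have H (s : seq (seq (bool * bool))) : measurable [set w | hist n w \in s] /\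
   (P [set w | hist n w \in s] <= (\sum_(l <- s) hist_mass n l)%:E)%E.
  elim: s => [|l s [m1 IH]].
    rewrite big_nil (_ : [set w | _] = set0) ?measure0 //.
    by apply/seteqP; split.
  have E : [set w | hist n w \in l :: s] = [set w | hist n w = l] `|` [set w | hist n w \in s].
    apply/seteqP; split => w /=; rewrite inE; first by move=> /orP[/eqP|]; [left|right].
    by move=> [->|->]; rewrite ?eqxx ?orbT.
  rewrite E; split; first by apply: measurableU => //; exact: measurable_hist.
  apply: le_trans; first exact: (measureU2 _ (measurable_hist n l) m1).
  rewrite big_cons EFinD; apply: leeD; last exact: IH.
  by have := lexx (hist_mass n l)%:E; rewrite -{1}hist_massE.
have [m1 m2] := H [seq l <- hists n | B l].
rewrite -big_filter; apply: le_trans m2; apply: le_measure; rewrite ?inE //; last first.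
  by move=> w /= Bw; rewrite mem_filter Bw mem_hists.
rewrite (_ : [set w | B (hist n w)] = [set w | hist n w \in [seq l <- hists n | B l]]) //.
by apply/seteqP; split => w /=; rewrite mem_filter mem_hists andbT.
Qed.

Lemma measurable_hist_pred n (B : pred (seq (bool * bool))) :
  measurable [set w | B (hist n w)].
Proof.
rewrite (_ : [set w | _] = \bigcup_(l in [set` [seq l <- hists n | B l]]) [set w | hist n w = l]).
  by apply: fin_bigcup_measurable => [|l _]; [exact: finite_seq|exact: measurable_hist].
apply/seteqP; split => w /=.
  by move=> Bw; exists (hist n w) => //=; rewrite mem_filter Bw mem_hists.
by move=> [l /=]; rewrite mem_filter => /andP[Bl _] ->.
Qed.

Lemma chebyshev_hist n (g : seq (bool * bool) -> R) e : 0 < e ->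
  (P [set w | (e <= `|g (hist n w)|)%R] <= (hist_mean n (fun l => g l ^+ 2) / e ^+ 2)%:E)%E.
Proof.
move=> e0; apply: le_trans (prob_hist_le n (fun l => e <= `|g l|)) _.
rewrite lee_fin ler_pdivlMr ?exprn_gt0 // mulr_suml /hist_mean big_mkcond /=.
apply: ler_sum => l _; case: ifPn => [eg|_].
  apply: ler_wpM2l; first exact: hist_mass_ge0.
  by rewrite -[leRHS]ger0_norm ?sqr_ge0 // normrX lerXn2r ?nnegrE // ltW.
by apply: mulr_ge0; [exact: hist_mass_ge0|exact: sqr_ge0].
Qed.

End law.

(** * From second moments to almost sure convergence *)

Lemma square_bracket (t : nat) : (0 < t)%N -> exists k, (k.+1 ^ 2 <= t < k.+2 ^ 2)%N.
Proof.
elim: t => // -[|t] IH _; first by exists 0%N.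
have [k /andP[k1 k2]] := IH isT.
have [lt|ge] := ltnP t.+2 (k.+2 ^ 2)%N; first by exists k; rewrite lt andbT ltnW.
exists k.+1; rewrite ge /= (leq_ltn_trans k2) // ltn_exp2r //.
Qed.

(* The partial sums are nondecreasing, and consecutive squares differ by a
   vanishing proportion. *)
Lemma cvg_time_average_squares (R : realType) (f : nat -> R) (c : R) :
  0 <= c -> (forall t, (0 < t)%N -> 0 <= f t) ->
  (forall m : nat, exists K : nat, forall k, (K <= k)%N ->
     `|\sum_(1 <= t < (k.+1 ^ 2).+1) f t - c * (k.+1 ^ 2)%:R| < (k.+1 ^ 2)%:R / m.+1%:R) ->
  time_average f @ \oo --> c.
Proof.
move=> c0 f0 H.
pose s n := \sum_(1 <= t < n.+1) f t.
have smono n m : (n <= m)%N -> s n <= s m.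
  move=> nm; rewrite /s [leRHS](big_cat_nat _ _ (n := n.+1)) //=.
  rewrite lerDl big_nat; apply: sumr_ge0 => t /andP[nt _]; apply: f0.
  exact: leq_ltn_trans nt.
apply/cvgrPdist_le => e e0.
(* The budget is [4/5 + 1/5] of [e]: the error at the upper square is at most [(x + 1) ^+ 2 / m.+1],
   with [(x + 1) ^+ 2 <= 4 * x ^+ 2]; the distance between the squares costs
   [c * (2 * x + 1) <= 3 * c * x]. *)
have [m me] : exists m : nat, m.+1%:R^-1 < e / 5.
  have e5 : 0 < e / 5 by rewrite divr_gt0.
  by have [m _ /(_ m (leqnn m))] := near_infty_natSinv_lt (PosNum e5); exists m.
have [K HK] := H m.
have [L HL] : exists L : nat, forall k, (L <= k)%N -> 3 * c / k.+1%:R <= e / 5.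
  pose L := Num.bound (3 * c / (e / 5)).
  have e5 : 0 < e / 5 by rewrite divr_gt0.
  exists L => k Lk; rewrite ler_pdivrMr // -ler_pdivrMl // mulrC.
  have : 3 * c / (e / 5) < L%:R.
    by apply: archi_boundP; apply: divr_ge0; [exact: mulr_ge0|exact: ltW].
  by move/ltW => H1; apply: le_trans H1 _; rewrite ler_nat leqW.
exists ((maxn K L).+1 ^ 2)%N => // tau /= Ktau.
have tau0 : (0 < tau)%N by apply: leq_trans Ktau; rewrite expn_gt0.
have [k /andP[k1 k2]] := square_bracket tau0.
have kKL : (maxn K L <= k)%N.
  by have := leq_ltn_trans Ktau k2; rewrite ltn_exp2r.
have kK : (K <= k)%N by apply: leq_trans kKL; exact: leq_maxl.
have kL : (L <= k)%N by apply: leq_trans kKL; exact: leq_maxr.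
have := HK _ kK; have := HK _ (leqW kK); have := HL _ kL.
rewrite -/(s _) -/(s _) => HL1 H2 H1.
have tauR : 0 < tau%:R :> R by rewrite ltr0n.
have S1 := smono _ _ k1; have S2 := smono _ _ (ltnW k2).
rewrite /time_average -/(s tau) distrC.
have -> : tau%:R^-1 * s tau - c = (s tau - c * tau%:R) / tau%:R.
  by field; rewrite gt_eqF.
rewrite normrM [X in _ * X]ger0_norm ?invr_ge0 ?(ltW tauR) // ler_pdivrMr //.
set x : R := k.+1%:R in HL1 *.
have x1 : 1 <= x by rewrite ler1n.
have E1 : (k.+1 ^ 2)%:R = x ^+ 2 :> R by rewrite natrX.
have E2 : (k.+2 ^ 2)%:R = (x + 1) ^+ 2 :> R by rewrite natrX -(natr1 k.+1).
have T1 : x ^+ 2 <= tau%:R by rewrite -E1 ler_nat.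
have T2 : tau%:R <= (x + 1) ^+ 2 by rewrite -E2 ler_nat ltnW.
rewrite E1 in H1; rewrite E2 in H2.
set i : R := m.+1%:R^-1 in me H1 H2 *.
have i0 : 0 < i by rewrite invr_gt0.
have HL2 : 3 * c * x <= e / 5 * x ^+ 2.
  rewrite ler_pdivrMr in HL1; last by apply: lt_le_trans x1.
  rewrite expr2 mulrA; apply: ler_wpM2r => //; exact: le_trans x1.
have x4 : (x + 1) ^+ 2 <= 4 * x ^+ 2 by rewrite !expr2; nra.
have i4 : (x + 1) ^+ 2 * i <= 4 * (e / 5 * tau%:R) by nra.
have i1 : x ^+ 2 * i <= e / 5 * tau%:R by nra.
have HL3 : 3 * c * x <= e / 5 * tau%:R.
  by apply: le_trans HL2 _; apply: ler_wpM2l => //; rewrite divr_ge0 // ltW.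
have ct1 : c * tau%:R <= c * (x + 1) ^+ 2 by exact: ler_wpM2l.
have ct2 : c * x ^+ 2 <= c * tau%:R by exact: ler_wpM2l.
have cx : c * (x + 1) ^+ 2 - c * x ^+ 2 <= 3 * c * x.
  rewrite (_ : _ - _ = c * (2 * x + 1)); last by ring.
  by rewrite -mulrA mulrCA; apply: ler_wpM2l => //; lra.
move: H1 H2; rewrite !ltr_norml => /andP[H1 H1'] /andP[H2 H2'].
rewrite ler_norml; apply/andP; split; lra.
Qed.

Lemma nneseries_inv_square_lt_pinfty (R : realType) (u : nat -> \bar R) (C : R) :
  (forall k, 0 <= u k)%E -> (forall k, u k <= (C / k.+1%:R ^+ 2)%:E)%E ->
  (\big[+%E/0%E]_(0 <= k <oo) u k < +oo)%E.
Proof.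
move=> u0 uC.
have C0 : 0 <= C.
  have := le_trans (u0 0%N) (uC 0%N).
  by rewrite lee_fin expr1n divr1.
apply: (@le_lt_trans _ _ (2 * C)%:E); last exact: ltry.
apply: lime_le; first by apply: is_cvg_nneseries => k _ _; exact: u0.
apply: nearW => n.
apply: (@le_trans _ _ (\sum_(0 <= k < n) (C / k.+1%:R ^+ 2)%:E)%E).
  by apply: lee_sum => k _; exact: uC.
rewrite sumEFin lee_fin.
(* The bound telescopes: [1 / x ^+ 2 <= 2 / x - 2 / (x + 1)] for [x >= 1]. *)
have : \sum_(0 <= k < n) C / k.+1%:R ^+ 2 <= 2 * C - 2 * C / n.+1%:R.
  elim: n => [|n IH]; first by rewrite big_geq // divr1; lra.
  rewrite big_nat_recr //=; apply: le_trans (lerD IH (lexx _)) _.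
  have x1 : 1 <= n.+1%:R :> R by rewrite ler1n.
  rewrite -(natr1 n.+1); set x : R := n.+1%:R in x1 *.
  rewrite -subr_ge0 (_ : _ - _ = C * (x - 1) / (x ^+ 2 * (x + 1))); last first.
    by field; rewrite !gt_eqF //; lra.
  apply: divr_ge0; apply: mulr_ge0 => //; first by rewrite subr_ge0.
    exact: sqr_ge0.
  by lra.
have : 0 <= 2 * C / n.+1%:R by rewrite divr_ge0 // mulr_ge0.
move=> H1 H2; by apply: le_trans H2 _; rewrite gerBl.
Qed.

(** * Linear growth of the second moment of the centred age sum *)

Section second_moment.
Context (R : realType) (d : measure_display) (T : measurableType d)
  (P : probability T R) (p r lambda : R) (S A : nat -> {RV P >-> bool}).
Hypotheses (hp : 0 < p < 1) (hr : 0 < r < 1) (hl : 0 < lambda < r / (p + r)).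
Hypotheses (hS : GE_channel p r S) (hA : bernoulli_arrivals lambda A)
  (hAS : independent_processes slots A S).
Local Notation c := (mean_age p r lambda).
Local Notation hist_mean := (hist_mean S A).

Lemma dev_second_moment : exists beta z C : R, 0 <= C /\
  forall n, (0 < n)%N -> hist_mean n (fun l => dev (run c beta z l) ^+ 2) <= C * n%:R.
Proof.
have /andP[l0 l1] := lambda01 hp hr hl.
have [w [z [rho [w0 z1 rho01 hw]]]] := queue_weights hp hr hl.
have z0 : 0 < z by exact: lt_trans z1.
pose rho0 := 1 - lambda + lambda / z.
have lz : 0 < lambda / z by exact: divr_gt0.
have r0 : 0 < rho0 by rewrite /rho0; lra.
have r1 : rho0 < 1.
  have : lambda / z < lambda by rewrite ltr_pdivrMr // ltr_pMr.
  by rewrite /rho0; lra.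
(* The inverse of the midpoint of [rho0] and 1, so that both [1 < beta] and [beta * rho0 < 1]
   hold. *)
pose beta := 2 / (1 + rho0).
have b1 : 1 < beta by rewrite /beta ltr_pdivlMr; lra.
have hb : beta * (1 - lambda + lambda / z) < 1.
  by rewrite -/rho0 /beta mulrAC ltr_pdivrMr; lra.
have [rho' [b [/andP[rp0 rp1] b0 HL]]] := lyap_drift hp hr hl w0 z1 rho01 hw b1 hb.
have [C1 C10 HV] := deviation_variance hp hr hl w0 z1 b1.
have [C2 C20 HD] := dev_sqr_le hp hr hl w0 z1 b1.
have I l : age_bound beta z (run c beta z l) by apply: age_bound_run; exact: ltW.
have RM := hist_mean_run hS hA hAS beta z.
pose one := hist_mean 1 (fun=> 1).
have one0 : 0 <= one by apply: hist_mean_ge0.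
have HE1 n : (0 < n)%N -> hist_mean n (fun=> 1) = one.
  elim: n => // -[|n] IH _ //; rewrite -(IH isT) (RM (fun=> 1)) //.
  apply: eq_bigr => l _; congr (_ * _).
  have T1 := tr_sum p r (channel (run c beta z l)).
  rewrite /next_mean (_ : GE_transition p r _ true =
    1 - GE_transition p r (channel (run c beta z l)) false); first ring.
  by rewrite -T1 addrK.
pose lp n := hist_mean n (fun l => lyap w z (run c beta z l)).
(* The second term is the fixed point of [x |-> rho' * x + b * one]; adding the initial value gives
   a bound preserved by the drift inequality. *)
pose M := lp 1%N + b * one / (1 - rho').
have lp0 n : 0 <= lp n.
  by apply: hist_mean_ge0 => l; apply: (lyap_ge0 w0 z1 (I l)).
have M0 : 0 <= b * one / (1 - rho').
  by apply: divr_ge0; [exact: mulr_ge0|lra].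
have lpM n : (0 < n)%N -> lp n <= M.
  elim: n => // -[|n] IH _; first by rewrite /M lerDl.
  have := IH isT => {}IH.
  rewrite /lp RM //.
  apply: (@le_trans _ _ (rho' * lp n.+1 + b * one)).
    rewrite -(HE1 n.+1) // -!hist_meanZ -hist_meanD; apply: ler_hist_mean => l; rewrite mulr1.
    by apply: HL; case: (I l).
  have := ler_wpM2l rp0 IH.
  have : b * one = (1 - rho') * (b * one / (1 - rho')) by field; lra.
  have : 0 <= (1 - rho') * lp 1%N by apply: mulr_ge0 => //; lra.
  rewrite /M; lra.
pose zz n := hist_mean n (fun l => deviation p r lambda (run c beta z l) ^+ 2).
have zz0 : 0 <= zz 1%N by apply: hist_mean_ge0 => l; exact: sqr_ge0.
have zzM n : zz n.+1 <= zz 1%N + C1 * M * n%:R.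
  elim: n => [|n IH]; first by rewrite mulr0 addr0.
  rewrite {1}/zz (RM (fun st => deviation p r lambda st ^+ 2)) //.
  apply: (@le_trans _ _ (zz n.+1 + C1 * lp n.+1)).
    by rewrite -hist_meanZ -hist_meanD; apply: ler_hist_mean => l; exact: HV.
  have := ler_wpM2l C10 (lpM _ (ltn0Sn n)).
  rewrite -natr1; lra.
have MM : 0 <= M by rewrite addr_ge0.
exists beta, z, (2 * (zz 1%N + C1 * M) + C2 * M); split.
  apply: addr_ge0; last exact: mulr_ge0.
  by apply: mulr_ge0 => //; apply: addr_ge0 => //; exact: mulr_ge0.
case=> // n _.
apply: (@le_trans _ _ (2 * zz n.+1 + C2 * lp n.+1)).
  by rewrite -!hist_meanZ -hist_meanD; apply: ler_hist_mean => l; exact: HD.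
have n1 : 1 <= n.+1%:R :> R by rewrite ler1n.
have q1 := zzM n; have q2 := ler_wpM2l C20 (lpM _ (ltn0Sn n)).
have q3 : zz 1%N <= zz 1%N * n.+1%:R by rewrite ler_peMr.
have q4 : C2 * M <= C2 * M * n.+1%:R by rewrite ler_peMr // mulr_ge0.
have q5 : C1 * M * n%:R <= C1 * M * n.+1%:R.
  by apply: ler_wpM2l; [exact: mulr_ge0|rewrite ler_nat].
lra.
Qed.

Lemma mean_age_ge0 : 0 <= c.
Proof.
have [l0 l1 h1 h2 h3] := params hp hr hl.
have /andP[r0 _] := hr; have /andP[p0 _] := hp.
rewrite /mean_age addr_ge0 ?invr_ge0 ?(ltW l0) // mulr_ge0 ?divr_ge0 ?(ltW p0) ?(ltW r0) //.
rewrite addr_ge0 ?invr_ge0 ?(ltW h3) // divr_ge0 ?sqr_ge0 // mulr_ge0 ?(ltW h1) //.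
by rewrite addr_ge0 ?(ltW h1) ?(ltW l0).
Qed.

Lemma fcfs_age_ge0 (a s : nat -> bool) t : (0 < t)%N -> 0 <= fcfs_age a s R t.
Proof. by case: t => // t _; rewrite -(age_run_history 0 1 1). Qed.

End second_moment.

Theorem lemma2 (R : realType) (d : measure_display) (T : measurableType d)
    (P : probability T R) (p r lambda : R)
    (S A : nat -> {RV P >-> bool})
    (hp : 0 < p < 1) (hr : 0 < r < 1) (hlambda : 0 < lambda < r / (p + r))
    (hS : GE_channel p r S)
    (hA : bernoulli_arrivals lambda A)
    (hAS : independent_processes slots A S) :
  {ae P, forall w,
    time_average (fcfs_age (A ^~ w) (S ^~ w) R) @ \oo -->
      lambda^-1 + p / r * ((p + r)^-1 +
        lambda ^+ 2 / ((r - (p + r) * lambda) *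
                       (r - (p + r) * lambda + lambda)))}.
Proof.
have [beta [z [C [C0 HC]]]] := dev_second_moment hp hr hlambda hS hA hAS.
pose c := mean_age p r lambda.
pose D (l : seq (bool * bool)) : R := dev (run c beta z l).
(* With [N = k.+1 ^ 2], Chebyshev bounds the probability of [F m k] by [C * N / (N / m.+1) ^+ 2 = C
   * m.+1 ^+ 2 / k.+1 ^+ 2], which is summable in [k]; this is the reason for passing to squares. *)
pose F (m k : nat) : set T :=
  [set w | (k.+1 ^ 2)%:R / m.+1%:R <= `|D (hist S A (k.+1 ^ 2) w)|].
have mF m k : measurable (F m k).
  exact: (measurable_hist_pred S A _ (fun l => (k.+1 ^ 2)%:R / m.+1%:R <= `|D l|)).
have F0 m : P (lim_sup_set (F m)) = 0%E.
  apply: lim_sup_set_cvg0 => //.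
  apply: (@nneseries_inv_square_lt_pinfty _ _ (C * m.+1%:R ^+ 2)) => k; first exact: measure_ge0.
  have N0 : 0 < (k.+1 ^ 2)%:R :> R by rewrite ltr0n expn_gt0.
  have e0 : 0 < (k.+1 ^ 2)%:R / m.+1%:R :> R by exact: divr_gt0.
  apply: le_trans (chebyshev_hist S A (k.+1 ^ 2)%N D e0) _.
  rewrite lee_fin ler_pdivrMr ?exprn_gt0 //.
  apply: le_trans (HC _ _) _; first by rewrite expn_gt0.
  rewrite natrX le_eqVlt; apply/orP; left; apply/eqP.
  have xn : k.+1%:R != 0 :> R by rewrite pnatr_eq0.
  have yn : m.+1%:R != 0 :> R by rewrite pnatr_eq0.
  by move: (k.+1%:R) (m.+1%:R) xn yn => x y xn yn; field; rewrite xn yn.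
have : {ae P, forall w, forall m : nat, ~ lim_sup_set (F m) w}.
  apply: ae_foralln => m; exists (lim_sup_set (F m)); split.
  - by apply: bigcap_measurable => // n _; apply: bigcup_measurable.
  - exact: F0.
  - by move=> w /= /contrapT.
apply: filterS => w Hw.
apply: cvg_time_average_squares.
- exact: mean_age_ge0.
- exact: fcfs_age_ge0.
move=> m; apply: contrapT => /forallNP H; apply: (Hw m) => n _.
have /existsNP[k] := H n.
move=> /not_implyP[nk /negP]; rewrite -leNgt => Hk.
exists k => //=; rewrite /F /= /D /hist dev_run_history.
exact: Hk.
Qed.
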